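(* Let $G$ be an infinite, locally finite, connected simple graph with a fixed vertex $a$, let $\psi:G\to\mathbb{C}$, and let $M_\psi$ be a bounded multiplication operator on $\hat{\mathcal{L}}$ (or equivalently on $\hat{\mathcal{L}}_0$). Then the following three statements are equivalent: (1) $M_\psi$ is compact on $\hat{\mathcal{L}}$. (2) $M_\psi$ is compact on $\hat{\mathcal{L}}_0$. (3) Both $$\lim_{d(a,v)\to\infty}\psi(v)=0\quad\text{and}\quad \lim_{d(a,v)\to\infty} d(a,v)\max_{w\in N_v}|\psi(v)-\psi(w)|=0 .$$
   Context: A graph is always connected, undirected, simple, with infinitely many vertices, each of finite degree; $G$ also denotes its vertex set, $v\sim w$ means $v$ and $w$ are adjacent, $N_v=\{w\in G: w\sim v\}$, and $d$ is the graph distance. $\lim_{d(a,v)\to\infty}F(v)=0$ means: for every $\epsilon>0$ there is $N\in\mathbb{N}$ such that $|F(v)|<\epsilon$ whenever $d(a,v)>N$. The Lipschitz space is $\hat{\mathcal{L}}=\{f:G\to\mathbb{C} : \sup_{v\sim w}|f(v)-f(w)|<\infty\}$ with norm $\|f\|_{\hat{\mathcal{L}}}^{a}:=|f(a)|+\sup_{v\sim w}|f(v)-f(w)|$. The little Lipschitz space $\hat{\mathcal{L}}_0$, with the same norm, is the set of $f\in\hat{\mathcal{L}}$ with $\lim_{d(a,v)\to\infty}\max_{w\in N_v}|f(v)-f(w)|=0$. Both are Banach spaces. $M_\psi f:=\psi f$; ''$M_\psi$ is bounded on $X$'' means $\psi f\in X$ for every $f\in X$ and $M_\psi:X\to X$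 is a bounded linear operator. Boundedness of $M_\psi$ on $\hat{\mathcal{L}}$ is equivalent to boundedness on $\hat{\mathcal{L}}_0$. *)

(* Defs.v *)
From HB Require Import structures.
From mathcomp Require Import all_boot all_order all_algebra finmap.
From mathcomp Require Import complex.
From mathcomp Require Import all_classical all_reals.
From mathcomp Require Import topology normedtype.

Set Implicit Arguments.
Unset Strict Implicit.
Unset Printing Implicit Defensive.

Import Order.TTheory GRing.Theory Num.Theory.
Import numFieldNormedType.Exports.
Import ComplexField.

Local Open Scope classical_set_scope.
Local Open Scope ring_scope.
Local Open Scope complex_scope.

Record graph := Graph {
  vertex :> choiceType;
  adj : rel vertex;
  adj_sym : symmetric adj;
  adj_irr : irreflexive adj;
  adj_connected : forall v w, exists2 p, path adj v p & last v p = w;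
  adj_locally_finite : forall v, finite_set [set w | adj v w];
  vertex_infinite : infinite_set [set: vertex] }.

Section graph_distance.
Variable G : graph.
Implicit Types v w : G.

Definition nbrs v : {fset G} := fset_set [set w | adj v w].

Lemma in_nbrs v w : (w \in nbrs v) = adj v w.
Proof.
rewrite /nbrs in_fset_set; last exact: adj_locally_finite.
by apply/idP/idP => [/set_mem|] // h; apply/mem_set.
Qed.

Definition walk v w (n : nat) : Prop :=
  exists p : seq G, [/\ path (@adj G) v p, last v p = w & size p = n].

Lemma walk_ex v w : exists n, `[< walk v w n >].
Proof.
have [p pp lp] := adj_connected v w.
by exists (size p); apply/asboolP; exists p.
Qed.

Definition dist v w : nat := ex_minn (walk_ex v w).

Definition vanishes_at_infty (K : numDomainType) (M : normedZmodType K)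
    (a : G) (F : G -> M) : Prop :=
  forall eps : K, 0 < eps ->
    exists N : nat, forall v, (N < dist a v)%N -> `|F v| < eps.

End graph_distance.

Section variation.
Variables (R : realType) (G : graph).
Implicit Types (f g : G -> R[i]) (v w : G).

(* [Normc.normc] is the complex modulus with values in [R]; the norm [`|_|] of
   [R[i]] takes its values in [R[i]], where suprema and maxima do not exist. *)
Definition edge_variations f : set R :=
  [set r | exists v w, adj v w /\ r = Normc.normc (f v - f w)].

Definition lipschitz_const f : R := sup (edge_variations f).

(* [nbrs v] is nonempty and the terms are nonnegative, so the default value 0
   does not affect the maximum. *)
Definition max_variation f v : R :=
  \big[Num.max/0]_(w <- nbrs v) Normc.normc (f v - f w).

Definition lip_pred : {pred G -> R[i]} :=
  fun f => `[< has_ubound (edge_variations f) >].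

Lemma normc_ge0 (z : R[i]) : 0 <= Normc.normc z.
Proof. by case: z => x y; exact: sqrtr_ge0. Qed.

Lemma normrE (z : R[i]) : `|z| = (Normc.normc z)%:C.
Proof. by case: z. Qed.

Lemma ler_max_variation f v w : adj v w ->
  Normc.normc (f v - f w) <= max_variation f v.
Proof.
rewrite -in_nbrs => vw; rewrite /max_variation.
exact: (@Order.TotalTheory.le_bigmax_seq _ R G (nbrs v) 0 w xpredT
  (fun w => Normc.normc (f v - f w)) vw isT).
Qed.

Lemma max_variation_ge0 f v : 0 <= max_variation f v.
Proof. by rewrite /max_variation; exact: bigmax_ge_id. Qed.

Lemma max_variation_le f v r : 0 <= r ->
  (forall w, adj v w -> Normc.normc (f v - f w) <= r) -> max_variation f v <= r.
Proof.
move=> r0 H; rewrite /max_variation big_seq; apply: bigmax_le => // w.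
by rewrite in_nbrs; exact: H.
Qed.

Lemma max_variationZD (c : R[i]) f g v : max_variation (c *: f + g) v <=
  Normc.normc c * max_variation f v + max_variation g v.
Proof.
apply: max_variation_le => [|w vw].
  by rewrite addr_ge0 ?mulr_ge0 ?max_variation_ge0 ?normc_ge0.
have -> : (c *: f + g) v - (c *: f + g) w = c * (f v - f w) + (g v - g w).
  rewrite -[(c *: f + g) v]/(c * f v + g v) -[(c *: f + g) w]/(c * f w + g w).
  by rewrite mulrBr opprD addrACA.
apply: (le_trans (le_normcD _ _)); rewrite Normc.normcM lerD //.
  by rewrite ler_wpM2l ?normc_ge0 ?ler_max_variation.
exact: ler_max_variation.
Qed.

Lemma lip_submod_closed : submod_closed lip_pred.
Proof.
split=> [|c f g /asboolP[A hA] /asboolP[B hB]]; apply/asboolP.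
  exists 0 => _ [v [w [_ ->]]].
  by rewrite -[(0 : G -> R[i]) v]/0 -[(0 : G -> R[i]) w]/0 subr0 Normc.normc0.
exists (Normc.normc c * A + B) => _ [v [w [vw ->]]].
have -> : (c *: f + g) v - (c *: f + g) w = c * (f v - f w) + (g v - g w).
  rewrite -[(c *: f + g) v]/(c * f v + g v) -[(c *: f + g) w]/(c * f w + g w).
  by rewrite mulrBr opprD addrACA.
apply: (le_trans (le_normcD _ _)); rewrite Normc.normcM lerD //.
  by rewrite ler_wpM2l ?normc_ge0 //; apply: hA; exists v, w.
by apply: hB; exists v, w.
Qed.

HB.instance Definition _ :=
  GRing.isSubmodClosed.Build R[i] (G -> R[i]) lip_pred lip_submod_closed.

End variation.

(* The set of functions does not depend on the base point [a], which is only
   recorded in the type because the norm depends on it. *)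
Record lip (R : realType) (G : graph) (a : G) := Lip {
  lip_fun :> G -> R[i];
  lip_funP : lip_fun \in @lip_pred R G }.

Section lip_space.
Variables (R : realType) (G : graph) (a : G).
Local Notation lip := (@lip R G a).

HB.instance Definition _ := [isSub for @lip_fun R G a].
HB.instance Definition _ := [Choice of lip by <:].
HB.instance Definition _ := [SubChoice_isSubLmodule of lip by <:].

Implicit Types f g : lip.

Definition lip_norm f : R[i] := `|f a| + (lipschitz_const f)%:C.

Lemma lip_edge_le f v w : adj v w ->
  Normc.normc (f v - f w) <= lipschitz_const f.
Proof.
move=> vw; apply: ub_le_sup; first exact/asboolP/(lip_funP f).
by exists v, w.
Qed.

Lemma has_edge : exists b : G, adj a b.
Proof.
have [b ba] : exists b : G, b != a.
  apply: contrapT => H; apply: (@vertex_infinite G).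
  apply: (@sub_finite_set _ _ [set a]); last exact: finite_set1.
  by move=> b _ /=; apply: contrapT => /eqP ba; apply: H; exists b.
have [[|c p] /=] := adj_connected a b; first by move=> _ e; rewrite e eqxx in ba.
by move=> /andP[ac _] _; exists c.
Qed.

Lemma edge_variations_nonempty (f : G -> R[i]) : edge_variations f !=set0.
Proof. by have [b ab] := has_edge; exists (Normc.normc (f a - f b)), a, b. Qed.

Lemma lipschitz_const_le f r :
  (forall v w, adj v w -> Normc.normc (f v - f w) <= r) ->
  lipschitz_const f <= r.
Proof.
move=> H; apply: ge_sup; first exact: edge_variations_nonempty.
by move=> _ [v [w [vw ->]]]; exact: H.
Qed.

Lemma lipschitz_const_ge0 f : 0 <= lipschitz_const f.
Proof.
have [b ab] := has_edge.
by apply: le_trans (lip_edge_le f ab); exact: normc_ge0.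
Qed.

Lemma lip_normD f g : lip_norm (f + g) <= lip_norm f + lip_norm g.
Proof.
rewrite /lip_norm addrACA lerD//; first exact: ler_normD.
rewrite -(rmorphD (real_complex R)) lecR; apply: lipschitz_const_le => v w vw.
rewrite -[(f + g) v]/(f v + g v) -[(f + g) w]/(f w + g w) opprD addrACA.
by apply: (le_trans (le_normcD _ _)); rewrite lerD ?lip_edge_le.
Qed.

Lemma lip_constZ_le (l : R[i]) f :
  lipschitz_const (l *: f) <= Normc.normc l * lipschitz_const f.
Proof.
apply: lipschitz_const_le => v w vw.
rewrite -[(l *: f) v]/(l * f v) -[(l *: f) w]/(l * f w) -mulrBr Normc.normcM.
by rewrite ler_wpM2l ?normc_ge0 ?lip_edge_le.
Qed.

Lemma lip_normZ (l : R[i]) f : lip_norm (l *: f) = `|l| * lip_norm f.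
Proof.
rewrite /lip_norm mulrDr -normrM; congr (_ + _).
rewrite normrE -rmorphM; congr (_%:C); apply/eqP.
rewrite eq_le lip_constZ_le andTb.
have [->|l0] := eqVneq l 0; first by rewrite Normc.normc0 mul0r lipschitz_const_ge0.
have := lip_constZ_le l^-1 (l *: f); rewrite scalerA mulVf// scale1r.
have nl : 0 < Normc.normc l.
  rewrite lt_def normc_ge0 andbT; apply: contra l0 => /eqP/Normc.eq0_normc ->.
  by rewrite eqxx.
by rewrite Normc.normcV ler_pdivlMl.
Qed.

Lemma lip_norm_eq0 f : lip_norm f = 0 -> f = 0.
Proof.
move=> /eqP; rewrite /lip_norm paddr_eq0 ?ler0c ?normc_ge0 ?lipschitz_const_ge0//.
move=> /andP[/eqP/normr0_eq0 fa /eqP f0].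
have {}f0 : lipschitz_const f = 0 by case: f0.
have E v w : adj v w -> f v = f w.
  move=> /(lip_edge_le f); rewrite f0 => h; apply/eqP; rewrite -subr_eq0.
  by apply/eqP/Normc.eq0_normc/eqP; rewrite eq_le h normc_ge0.
have P p x : path (@adj G) x p -> f (last x p) = f x.
  by elim: p x => //= c p IH x /andP[xc /IH ->]; rewrite (E _ _ xc).
apply: val_inj; apply/funext => v /=; have [p ap <-] := adj_connected a v.
by rewrite (P _ _ ap) fa.
Qed.

HB.instance Definition _ := @Lmodule_isNormed.Build R[i] lip
  lip_norm lip_normD lip_normZ lip_norm_eq0.

Definition little_lip_pred : {pred lip} :=
  fun f => `[< vanishes_at_infty a (max_variation f) >].

Lemma little_lip_submod_closed : submod_closed little_lip_pred.
Proof.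
split=> [|c f g /asboolP hf /asboolP hg]; apply/asboolP => e e0.
  exists 0%N => v _; rewrite ger0_norm ?max_variation_ge0//.
  apply: le_lt_trans e0; apply: max_variation_le => // w _.
  by rewrite -[(0 : lip) v]/(0 : R[i]) -[(0 : lip) w]/(0 : R[i]) subr0 Normc.normc0.
have c0 : 0 < Normc.normc c + 1 by rewrite ltr_wpDl ?normc_ge0.
have [N hN] := hf (e / 2 / (Normc.normc c + 1)) ltac:(by rewrite !divr_gt0).
have [P hP] := hg (e / 2) ltac:(by rewrite divr_gt0).
exists (maxn N P) => v; rewrite gtn_max => /andP[/hN + /hP].
rewrite !ger0_norm ?max_variation_ge0// => hfv hgv.
apply: (le_lt_trans (max_variationZD c f g v)).
rewrite [e]splitr ler_ltD//.
apply: (@le_trans _ _ ((Normc.normc c + 1) * max_variation f v)).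
  by rewrite ler_wpM2r ?max_variation_ge0// lerDl.
by rewrite -ler_pdivlMl// mulrC ltW.
Qed.

HB.instance Definition _ :=
  GRing.isSubmodClosed.Build R[i] lip little_lip_pred little_lip_submod_closed.

End lip_space.

Record little_lip (R : realType) (G : graph) (a : G) := LittleLip {
  little_lip_val :> lip R a;
  little_lip_valP : little_lip_val \in @little_lip_pred R G a }.

Section little_lip_space.
Variables (R : realType) (G : graph) (a : G).
Local Notation little_lip := (@little_lip R G a).

HB.instance Definition _ := [isSub for @little_lip_val R G a].
HB.instance Definition _ := [Choice of little_lip by <:].
HB.instance Definition _ := [SubChoice_isSubLmodule of little_lip by <:].

Definition little_lip_norm (f : little_lip) : R[i] := `|little_lip_val f|.

Lemma little_lip_normD f g :
  little_lip_norm (f + g) <= little_lip_norm f + little_lip_norm g.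
Proof. exact: ler_normD. Qed.

Lemma little_lip_normZ (l : R[i]) f :
  little_lip_norm (l *: f) = `|l| * little_lip_norm f.
Proof. exact: normrZ. Qed.

Lemma little_lip_norm_eq0 f : little_lip_norm f = 0 -> f = 0.
Proof. by move=> /normr0_eq0 f0; exact: val_inj. Qed.

HB.instance Definition _ := @Lmodule_isNormed.Build R[i] little_lip
  little_lip_norm little_lip_normD little_lip_normZ little_lip_norm_eq0.

End little_lip_space.

Section operators.
Variables (K : numFieldType) (X Y : normedModType K).

Definition bounded_operator (T : {linear X -> Y}) : Prop :=
  exists M : K, forall x, `|T x| <= M * `|x|.

Definition compact_operator (T : {linear X -> Y}) : Prop :=
  forall A : set X, bounded_set A -> precompact (T @` A).

End operators.

(* [X] is a space of functions on [G] through [ev]. An operator on [X] acting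
   as the multiplication by [psi] exists iff [psi * f] is in [X] for all [f] in
   [X], and it is unique when [ev] is injective. *)
Section multiplication_operators.
Variables (R : realType) (G : graph) (X : normedModType R[i]).
Variables (ev : X -> G -> R[i]) (psi : G -> R[i]).

Definition multiplies (T : {linear X -> X}) : Prop :=
  forall f v, ev (T f) v = psi v * ev f v.

Definition mult_bounded : Prop :=
  exists2 T : {linear X -> X}, multiplies T & bounded_operator T.

Definition mult_compact : Prop :=
  exists2 T : {linear X -> X}, multiplies T & compact_operator T.

End multiplication_operators.

Definition mult_bounded_lip (R : realType) (G : graph) (a : G) psi :=
  mult_bounded (fun f : lip R a => f : G -> R[i]) psi.
Definition mult_bounded_little_lip (R : realType) (G : graph) (a : G) psi :=
  mult_bounded (fun f : little_lip R a => f : G -> R[i]) psi.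
Definition mult_compact_lip (R : realType) (G : graph) (a : G) psi :=
  mult_compact (fun f : lip R a => f : G -> R[i]) psi.
Definition mult_compact_little_lip (R : realType) (G : graph) (a : G) psi :=
  mult_compact (fun f : little_lip R a => f : G -> R[i]) psi.

(* Main.v *)
Require Import Defs.
From HB Require Import structures.
From mathcomp Require Import all_boot all_order all_algebra finmap.
From mathcomp Require Import complex.
From mathcomp Require Import all_classical all_reals.
From mathcomp Require Import topology normedtype.
From mathcomp Require Import zify ring lra.
Import Order.TTheory GRing.Theory Num.Theory.
Import numFieldNormedType.Exports.
Local Open Scope ring_scope.
Local Open Scope complex_scope.
Local Open Scope classical_set_scope.
Set Implicit Arguments.
Unset Strict Implicit.
Unset Printing Implicit Defensive.

(** Write [d] for the distance to [a]. Everything is reduced to one operator,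
    [f |-> psi f], seen either as a map [little_lip -> lip] or as a map
    [lip -> little_lip]. Compactness on [lip] or on [little_lip] gives
    compactness [little_lip -> lip], by composing with the isometric inclusion;
    this weakest form already forces the decay of [psi]. Conversely, the decay
    of [psi] gives compactness [lip -> little_lip], the strongest form, which
    yields the other two by composing with the inclusion again.

    Compactness forces decay. Let [t_v] be tents with apex [v], of slope at
    most 2 and of height at most [d(v)]. They are bounded in norm, have finite
    support, and vanish at any given vertex as soon as [v] is far away. Hence
    the only possible cluster point of [psi t_v] is 0, and compactness upgrades
    this to [psi t_v -> 0] in norm ([compact_vanishes]). On an edge at the apex
    the norm sees [psi v] when the height is 1, which gives the first limit, and
    [d(v) * (psi v - psi w)] up to [2 * |psi w|] when the height is [d(v)],
    which together with the first limit gives the second.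

    Decay forces compactness. A function [f] in the ball of radius [r] satisfies
    [|f v| <= r (1 + d(v))], so the product rule bounds the variation of
    [psi f] at [v] by [r] times
    [(d(v) + 2) * max_variation psi v + |psi v|] ([mult_variation_le]), which
    tends to 0. This puts [psi f] in [little_lip], and it makes the contribution
    of far vertices uniformly small over the ball; the near vertices are finite
    in number. So on the ball, [f |-> psi f] is continuous from pointwise
    convergence to the norm ([mult_near]). The ball is compact for pointwise
    convergence by Tychonoff's theorem ([compact_lip_ball]), and therefore so is
    its image ([mult_little_lip_compact]). *)

(** * Graph distance *)

Section GraphDistance.
Variable G : graph.
Implicit Types v w u : G.

Lemma dist_walk v w : walk v w (dist v w).
Proof. by rewrite /dist; case: ex_minnP => n /asboolP. Qed.

Lemma dist_le_walk v w n : walk v w n -> (dist v w <= n)%N.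
Proof. by move=> vw; rewrite /dist; case: ex_minnP => m _; apply; apply/asboolP. Qed.

Lemma distvv v : dist v v = 0%N.
Proof. by apply/eqP; rewrite -leqn0; apply: dist_le_walk; exists [::]. Qed.

Lemma dist_eq0 v w : dist v w = 0%N -> v = w.
Proof. by move=> vw; have := dist_walk v w; rewrite vw => -[[|x p] [_ <- //]]. Qed.

Lemma dist_triangle u v w : (dist v w <= dist v u + dist u w)%N.
Proof.
have [p [pp lp <-]] := dist_walk v u; have [q [pq lq <-]] := dist_walk u w.
by apply: dist_le_walk; exists (p ++ q); rewrite cat_path pp last_cat lp size_cat.
Qed.

Lemma dist_sym_le v w : (dist w v <= dist v w)%N.
Proof.
have [p [pp lp <-]] := dist_walk v w; apply: dist_le_walk.
exists (rev (belast v p)); split; last by rewrite size_rev size_belast.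
  by rewrite -lp rev_path (eq_path (e' := @adj G)) // => x y; rewrite adj_sym.
by case: p lp {pp} => [<- //|x p _] /=; rewrite rev_cons last_rcons.
Qed.

Lemma dist_sym v w : dist v w = dist w v.
Proof. by apply/eqP; rewrite eqn_leq !dist_sym_le. Qed.

Lemma dist_adj v w : adj v w -> dist v w = 1%N.
Proof.
move=> vw; apply/eqP; rewrite eqn_leq; apply/andP; split.
  by apply: dist_le_walk; exists [:: w]; rewrite /= vw.
by rewrite lt0n; apply: contraTN vw => /eqP/dist_eq0 ->; rewrite adj_irr.
Qed.

Lemma dist_adj_le u v w : adj v w -> (dist u w <= (dist u v).+1)%N.
Proof. by move=> vw; have := dist_triangle v u w; rewrite (dist_adj vw) addn1. Qed.

(** Local finiteness makes balls finite; this is what turns statements at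
    infinity into statements about all but finitely many vertices. *)
Lemma finite_ball v n : finite_set [set w | (dist v w <= n)%N].
Proof.
elim: n => [|n IHn].
  apply: sub_finite_set (finite_set1 v) => w /=.
  by rewrite leqn0 => /eqP/dist_eq0.
pose B := [set w | (dist v w <= n)%N].
apply: (@sub_finite_set _ _ (B `|` \bigcup_(u in B) [set w | adj u w])); last first.
  rewrite finite_setU; split=> //; apply: bigcup_finite => // u _.
  exact: adj_locally_finite.
move=> w /=; rewrite leq_eqVlt ltnS => /orP[/eqP vw|]; last by left.
right; have := dist_walk v w; rewrite vw => -[p [pp <- sp]].
case/lastP: p pp sp => // p x; rewrite rcons_path last_rcons size_rcons.
move=> /andP[pp px] [sp]; exists (last v p) => //=.
by rewrite /B /= -sp; apply: dist_le_walk; exists p.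
Qed.

Lemma vanishes_bounded (R : realType) (a : G) (F : G -> R) :
  vanishes_at_infty a F -> exists M, forall v, F v <= M.
Proof.
move=> /(_ 1 ltr01)[n far].
have finB := finite_ball a n.
pose S := \sum_(v <- fset_set [set w | (dist a w <= n)%N]) `|F v|.
have S0 : 0 <= S by rewrite sumr_ge0.
exists (1 + S) => v.
apply: (le_trans (ler_norm _)); case: (leqP (dist a v) n) => [vn|/far]; last first.
  by move=> Fv; rewrite -[leLHS]addr0 lerD // ltW.
rewrite -[leLHS]add0r lerD //.
have vB : v \in fset_set [set w | (dist a w <= n)%N].
  by rewrite in_fset_set //; apply/mem_set.
by rewrite /S (big_rem v vB) /= lerDl sumr_ge0.
Qed.

End GraphDistance.

(** * Compact operators *)

Section BoundedOperators.
Variables (K : numFieldType) (X Y : normedModType K).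

(** On the zero space a bound [M] can be any element of [K], hence not even
    real; its modulus is a bound that can be used in estimates. *)
Lemma bounded_operatorW (T : {linear X -> Y}) (M : K) x :
  (forall x, `|T x| <= M * `|x|) -> `|T x| <= `|M| * `|x|.
Proof.
move=> TM; have Mx0 : 0 <= M * `|x| by apply: le_trans (TM x).
by rewrite -[X in _ * X]normr_id -normrM (ger0_norm Mx0).
Qed.

Lemma bounded_operator_continuous (T : {linear X -> Y}) :
  bounded_operator T -> continuous T.
Proof.
move=> [M TM]; apply/linear_bounded_continuous/linear_boundedP.
near=> r => x; apply: (le_trans (bounded_operatorW x TM)).
apply: ler_wpM2r => //; near: r; apply: nbhs_pinfty_ge; exact: normr_real.
Unshelve. all: by end_near. Qed.

End BoundedOperators.

Section CompactOperators.
Variables (K : numFieldType) (X Y Z : normedModType K).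

Lemma compact_comp_bounded (J : {linear X -> Y}) (T : {linear Y -> Z}) :
  bounded_operator J -> compact_operator T ->
  compact_operator (T \o J : {linear X -> Z}).
Proof.
move=> [M JM] cT A [N [Nreal bA]]; rewrite -image_comp; apply: cT.
exists (`|M| * (`|N| + 1)).
split=> [|r Mr _ [x Ax <-]]; first by rewrite realM ?realD ?normr_real.
apply: (le_trans (bounded_operatorW x JM)); apply: le_trans (ltW Mr).
apply: ler_wpM2l => //; apply: bA Ax.
by apply: (le_lt_trans (real_ler_norm Nreal)); rewrite ltrDl.
Qed.

Lemma bounded_comp_compact (T : {linear X -> Y}) (J : {linear Y -> Z}) :
  compact_operator T -> bounded_operator J ->
  compact_operator (J \o T : {linear X -> Z}).
Proof.
move=> cT bJ A /cT; rewrite precompactE => cTA.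
have cJ : continuous J by exact: bounded_operator_continuous.
apply: (@precompact_subset _ _ (J @` closure (T @` A))).
  by rewrite -image_comp; apply: image_subset; exact: subset_closure.
apply: compact_precompact; first exact: norm_hausdorff.
by apply: continuous_compact => //; exact: continuous_subspaceT.
Qed.

End CompactOperators.

(** * Lipschitz functions *)

Section LipschitzFunctions.
Variables (R : realType) (G : graph) (a : G).
Implicit Types (f g psi : G -> R[i]) (v w : G).
Local Notation normc := Normc.normc.

Lemma gt0_complexP (e : R[i]) : 0 < e -> exists2 r : R, 0 < r & e = r%:C.
Proof. by case: e => x y; rewrite ltcE /= => /andP[/eqP-> x0]; exists x. Qed.

Lemma vanishes_normc psi :
  vanishes_at_infty a psi <-> vanishes_at_infty a (fun v => normc (psi v)).
Proof.
split=> h e => [e0|/gt0_complexP[r r0 ->]].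
  have [|n far] := h e%:C; first by rewrite ltcR.
  exists n => v /far; rewrite Defs.normrE ltcR.
  by rewrite ger0_norm ?normc_ge0.
have [n far] := h r r0; exists n => v /far.
by rewrite Defs.normrE ltcR ger0_norm ?normc_ge0.
Qed.

(** These sets stand in for the norm balls, since the norm ball of radius [r]
    lies in [lip_ball r]. Each condition involves the values at one or two
    vertices only, so closedness for pointwise convergence is immediate, and
    [f] need not be known to be Lipschitz beforehand. *)
Definition lip_ball (r : R) : set (G -> R[i]) :=
  [set f | normc (f a) <= r /\ forall v w, adj v w -> normc (f v - f w) <= r].

Lemma lip_ball_growth r f v :
  lip_ball r f -> normc (f v) <= r * (dist a v).+1%:R.
Proof.
move=> [fa fE]; have [p [pp <- <-]] := dist_walk a v.
elim/last_ind: p pp => [|p x IH] /=; first by rewrite mulr1.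
rewrite rcons_path last_rcons size_rcons => /andP[/IH {}IH px].
rewrite -[f x](subrK (f (last a p))); apply: (le_trans (le_normcD _ _)).
rewrite -natr1 mulrDr mulr1 addrC lerD // -normcN opprB; exact: fE.
Qed.

Lemma lip_ball_ge0 r f : lip_ball r f -> 0 <= r.
Proof. by move=> [fa _]; apply: le_trans fa; exact: normc_ge0. Qed.

Lemma lip_ball_lip r f : lip_ball r f -> f \in @lip_pred R G.
Proof. by move=> [_ fE]; apply/asboolP; exists r => _ [v [w [/fE + ->]]]. Qed.

Lemma lip_ballB r s f g :
  lip_ball r f -> lip_ball s g -> lip_ball (r + s) (fun v => f v - g v).
Proof.
move=> [fa fE] [ga gE]; split=> [|v w vw].
  by apply: (le_trans (le_normcD _ _)); rewrite normcN lerD.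
have -> : f v - g v - (f w - g w) = (f v - f w) - (g v - g w) by ring.
by apply: (le_trans (le_normcD _ _)); rewrite normcN lerD ?fE ?gE.
Qed.

Lemma lip_normrE (f : lip R a) :
  `|f| = (normc (f a) + lipschitz_const f)%:C.
Proof. by rewrite (rmorphD (real_complex R)) /= -Defs.normrE. Qed.

Lemma lip_norm_ball (f : lip R a) r : `|f| <= r%:C -> lip_ball r f.
Proof.
rewrite lip_normrE lecR => fr; split=> [|v w /(lip_edge_le f) fvw].
  by apply: le_trans fr; rewrite lerDl lipschitz_const_ge0.
by apply: le_trans fr; apply: (le_trans fvw); rewrite lerDr normc_ge0.
Qed.

Lemma lip_norm_le (f : lip R a) r s :
  normc (f a) <= r -> (forall v w, adj v w -> normc (f v - f w) <= s) ->
  `|f| <= (r + s)%:C.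
Proof. by move=> fa fE; rewrite lip_normrE lecR lerD // lipschitz_const_le. Qed.

(** For [f] in [lip_ball r], the product rule bounds the variation of
    [psi * f] at [v] by [r] times this quantity, since [f] grows at most
    linearly. *)
Definition mult_weight psi v : R :=
  (dist a v).+2%:R * max_variation psi v + normc (psi v).

Lemma mult_variation_le psi r f v w : lip_ball r f -> adj v w ->
  normc (psi v * f v - psi w * f w) <= r * mult_weight psi v.
Proof.
move=> fr vw; have [_ fE] := fr.
have -> : psi v * f v - psi w * f w =
    (psi v - psi w) * f w + psi v * (f v - f w) by ring.
apply: (le_trans (le_normcD _ _)); rewrite !Normc.normcM /mult_weight mulrDr.
apply: lerD; last by rewrite mulrC ler_wpM2r ?normc_ge0 ?fE.
rewrite mulrA mulrC ler_pM ?normc_ge0 ?ler_max_variation //.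
apply: (le_trans (lip_ball_growth w fr)).
by rewrite ler_wpM2l ?(lip_ball_ge0 fr) // ler_nat ltnS dist_adj_le.
Qed.

Lemma mult_weight_ge0 psi v : 0 <= mult_weight psi v.
Proof. by rewrite addr_ge0 ?mulr_ge0 ?max_variation_ge0 ?normc_ge0. Qed.

Lemma mult_weight_vanishes psi :
  vanishes_at_infty a psi ->
  vanishes_at_infty a (fun v => (dist a v)%:R * max_variation psi v) ->
  vanishes_at_infty a (mult_weight psi).
Proof.
move=> /vanishes_normc psi0 var0 e e0.
have e4 : 0 < e / 4 by rewrite divr_gt0.
have [m far1] := psi0 _ e4; have [n far2] := var0 _ e4.
exists (m + n)%N => v mnv.
have /far1 : (m < dist a v)%N by lia.
have /far2 : (n < dist a v)%N by lia.
rewrite !ger0_norm ?mulr_ge0 ?max_variation_ge0 ?mult_weight_ge0 ?normc_ge0 //.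
have : (dist a v).+2%:R * max_variation psi v <=
    3 * ((dist a v)%:R * max_variation psi v).
  by rewrite mulrA ler_wpM2r ?max_variation_ge0 // -natrM ler_nat; lia.
rewrite /mult_weight; lra.
Qed.

End LipschitzFunctions.

(** * Compactness forces decay *)

Section TestFunctions.
Variables (R : realType) (G : graph) (a : G).
Implicit Types (v w u : G) (h : nat).
Local Notation normc := Normc.normc.

Definition tent h v u : nat := (h - (dist v u).*2)%N.

Lemma tent_adj_le h v u w : adj u w -> (tent h v u <= tent h v w + 2)%N.
Proof. by move=> uw; have := dist_adj_le v uw; rewrite /tent; lia. Qed.

Lemma tent_far h v u : (h <= (dist v u).*2)%N -> tent h v u = 0%N.
Proof. by rewrite /tent; lia. Qed.

Definition tent_fun h v : G -> R[i] := fun u => (tent h v u)%:R.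

Lemma normc_nat n : normc (n%:R : R[i]) = n%:R.
Proof. by apply: complexI; rewrite -Defs.normrE normr_nat rmorph_nat. Qed.

Lemma tent_fun_adj_le h v u w : adj u w ->
  normc (tent_fun h v u - tent_fun h v w) <= 2.
Proof.
have main m n : (m <= n + 2)%N -> (n <= m)%N ->
    normc (m%:R - n%:R : R[i]) <= 2.
  by move=> mn nm; rewrite -natrB // normc_nat ler_nat; lia.
move=> uw; have wu : adj w u by rewrite adj_sym.
case: (leqP (tent h v w) (tent h v u)) => [|/ltnW] le_uw; last rewrite -normcN opprB.
  by apply: main => //; exact: tent_adj_le.
by apply: main => //; exact: tent_adj_le.
Qed.

Lemma tent_fun_lip h v : tent_fun h v \in @lip_pred R G.
Proof.
by apply/asboolP; exists 2 => _ [u [w [uw ->]]]; exact: tent_fun_adj_le.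
Qed.

Lemma tent_fun_little_lip h v : Lip a (tent_fun_lip h v) \in @little_lip_pred R G a.
Proof.
apply/asboolP => e e0; exists (dist a v + h + 1)%N => u far.
have ua := dist_triangle v a u.
rewrite ger0_norm ?max_variation_ge0 //; apply: le_lt_trans e0.
apply: max_variation_le => // w uw; rewrite /= /tent_fun.
rewrite !tent_far ?subrr ?Normc.normc0 //; first last.
  by lia.
by have := dist_adj_le v (etrans (adj_sym w u) uw); lia.
Qed.

Definition tent_little_lip h v : little_lip R a :=
  LittleLip (tent_fun_little_lip h v).

Lemma tent_norm_le h v : (h <= dist a v)%N -> `|tent_little_lip h v| <= 2%:C.
Proof.
move=> hv; rewrite -[leLHS]/(`|Lip a (tent_fun_lip h v)|) -[2]add0r.
apply: lip_norm_le => [|u w]; last exact: tent_fun_adj_le.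
rewrite /= /tent_fun tent_far ?Normc.normc0 // dist_sym; lia.
Qed.

(** The vanishing at each vertex [u] forces every cluster point of the images
    to be the zero function, and compactness turns this into convergence in
    norm. *)
Lemma compact_vanishes (X : normedModType R[i]) (S : {linear X -> lip R a})
    (x : G -> X) (M : R) :
  compact_operator S -> (forall v, `|x v| <= M%:C) ->
  (forall u, exists n, forall v, (n < dist a v)%N -> S (x v) u = 0) ->
  vanishes_at_infty a (fun v => S (x v)).
Proof.
move=> cS xM Sx0 e e0; apply: contrapT => /forallNP far.
have /choice[s sP] n : exists v, (n < dist a v)%N /\ ~ (`|S (x v)| < e).
  by have /existsNP[v /not_implyP[nv Sxv]] := far n; exists v.
pose y n := S (x (s n)).
have [p [_ clp]] : closure (S @` range x) `&` cluster (y @ \oo) !=set0.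
  have : compact (closure (S @` range x)).
    rewrite -precompactE; apply: cS; exists M%:C.
    split=> [|r Mr _ [v _ <-]]; last by apply: le_trans (ltW Mr).
    by apply/ger0_real; apply: le_trans (xM a).
  apply; exists 0%N => // n _ /=; apply: subset_closure.
  by exists (x (s n)) => //; exists (s n).
have tail n B : nbhs p B -> exists2 k, (n <= k)%N & B (y k).
  move=> /(clp [set y k | k in [set k | (n <= k)%N]] B).
  case=> [|_ [[k nk <-] Byk]]; last by exists k.
  by exists n => // k /= nk; exists k.
have p0 : p = 0.
  apply: val_inj; apply/funext => u /=.
  apply: Normc.eq0_normc; apply/eqP; rewrite eq_le normc_ge0 andbT leNgt.
  apply/negP => pu0; have [n Sx0u] := Sx0 u.
  pose d : R := normc (p u) / 2 / (dist a u).+1%:R.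
  have d0 : 0 < d by rewrite !divr_gt0.
  have [|k nk] := tail n (ball p d%:C).
    by apply: nbhsx_ballx; rewrite ltcR.
  rewrite -ball_normE /= => /ltW/lip_norm_ball/lip_ball_growth => /(_ u).
  rewrite -[(p - y k) u]/(p u - y k u) /y Sx0u ?(leq_ltn_trans nk (sP k).1) //.
  by rewrite subr0 /d divfK ?pnatr_eq0 //; lra.
have [|k _] := tail 0%N (ball p e); first exact: nbhsx_ballx.
by rewrite -ball_normE /= p0 sub0r normrN; have [_] := sP k.
Qed.

Section Necessity.
Variables (psi : G -> R[i]) (S : {linear little_lip R a -> lip R a}).
Hypothesis S_mult : forall f v, S f v = psi v * f v.
Hypothesis S_compact : compact_operator S.

Lemma mult_tent_vanishes (h : G -> nat) : (forall v, h v <= dist a v)%N ->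
  vanishes_at_infty a (fun v => S (tent_little_lip (h v) v)).
Proof.
move=> hd; apply: (@compact_vanishes _ _ _ 2) => // [v|u].
  exact: tent_norm_le.
exists (dist a u).*2 => v far; rewrite S_mult /= /tent_fun tent_far ?mulr0 //.
have := hd v; have := dist_triangle u a v; rewrite (dist_sym u v); lia.
Qed.

(** The tent of height 1 is the indicator of its apex. *)
Lemma compact_mult_vanishes : vanishes_at_infty a psi.
Proof.
move=> e e0.
have [v|n far] := @mult_tent_vanishes (fun v => minn 1 (dist a v)) _ e e0.
  exact: geq_minr.
exists n => v nv; have [w vw] := has_edge v.
apply: le_lt_trans (far v nv); set f := S _.
have fv : f v = psi v.
  by rewrite /f S_mult /= /tent_fun /tent distvv (_ : _ - _ = 1)%N ?mulr1 //; lia.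
have fw : f w = 0.
  by rewrite /f S_mult /= /tent_fun tent_far ?mulr0 // (dist_adj vw); lia.
rewrite lip_normrE Defs.normrE lecR; apply: ler_wpDl; first exact: normc_ge0.
by have := lip_edge_le f vw; rewrite fv fw subr0.
Qed.

(** The tent of height [dist a v] has slope 2 everywhere, so that next to its
    apex [v] the variation of its product with [psi] is
    [dist a v * |psi v - psi w|] up to an error [2 * |psi w|]. *)
Lemma compact_mult_variation_vanishes :
  vanishes_at_infty a (fun v => (dist a v)%:R * max_variation psi v).
Proof.
move=> e e0; have e4 : 0 < e / 4 by rewrite divr_gt0.
have e8 : 0 < e / 8 by rewrite divr_gt0.
have e4C : 0 < (e / 4)%:C by rewrite ltcR.
have [//|m far1] := @mult_tent_vanishes (dist a) _ _ e4C.
have [n far2] := (vanishes_normc a psi).1 compact_mult_vanishes _ e8.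
exists (m + n.+1)%N => v mnv.
have d0 : 0 < (dist a v)%:R :> R by rewrite ltr0n; lia.
rewrite ger0_norm ?mulr_ge0 ?max_variation_ge0 //.
apply: (@le_lt_trans _ _ (e / 2)); last by lra.
rewrite mulrC -ler_pdivlMr //; apply: max_variation_le => [|w vw].
  by rewrite !divr_ge0 // ltW.
rewrite ler_pdivlMr //.
have /far1/ltW/lip_norm_ball[_ /(_ v w vw)] : (m < dist a v)%N by lia.
have wv : adj w v by rewrite adj_sym.
have /far2 : (n < dist a w)%N by have := dist_adj_le a wv; lia.
rewrite ger0_norm ?normc_ge0 // !S_mult /=.
have := tent_fun_adj_le (dist a v) v vw; set t := tent_fun _ _ => tvw psiw edge.
have tv : t v = (dist a v)%:R by rewrite /t /tent_fun /tent distvv subn0.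
rewrite -normc_nat -Normc.normcM -tv.
have -> : (psi v - psi w) * t v =
   (psi v * t v - psi w * t w) - psi w * (t v - t w) by ring.
apply: (le_trans (le_normcD _ _)); rewrite normcN Normc.normcM.
have := ler_pM (normc_ge0 _) (normc_ge0 _) (ltW psiw) tvw; lra.
Qed.

End Necessity.

End TestFunctions.

(** * Decay forces compactness *)

Section ComplexPlane.
Variable R : realType.
Local Notation C := (R[i] : numFieldType).
Local Notation normc := Normc.normc.

Lemma normc_le_sum (x y : R) : normc (x +i* y) <= `|x| + `|y|.
Proof.
rewrite -[in leRHS](sqrtr_sqr x) -[in leRHS](sqrtr_sqr y).
have -> : x +i* y = (x +i* 0) + (0 +i* y) by rewrite [RHS]/= /(_ + _)/= addr0 add0r.
by apply: (le_trans (le_normcD _ _)); rewrite /= expr0n /= addr0 add0r.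
Qed.

Lemma continuous_complex : continuous (fun p : R * R => p.1 +i* p.2 : C).
Proof.
move=> p; apply/cvgrPdist_lt => _ /gt0_complexP[e e0 ->].
have e2 : 0 < e / 2 by rewrite divr_gt0.
near=> q; rewrite Defs.normrE ltcR.
apply: (le_lt_trans (normc_le_sum _ _)); rewrite [e]splitr ltrD //.
  by near: q; apply: cvgr_dist_lt => //; exact: cvg_fst.
by near: q; apply: cvgr_dist_lt => //; exact: cvg_snd.
Unshelve. all: by end_near. Qed.

Lemma compact_square (c : R) :
  compact [set z : C | `|complex.Re z| <= c /\ `|complex.Im z| <= c].
Proof.
have -> : [set z : C | `|complex.Re z| <= c /\ `|complex.Im z| <= c] =
    (fun p => p.1 +i* p.2 : C) @` (`[- c, c] `*` `[- c, c]).
  apply/seteqP; split=> [[x y] /= [xc yc]|_ [[x y] /= [xc yc] <-] /=].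
    by exists (x, y) => //=; rewrite !in_itv /= -!ler_norml.
  by move: xc yc; rewrite !in_itv /= -!ler_norml.
apply: continuous_compact; first exact/continuous_subspaceT/continuous_complex.
by apply: compact_setX; exact: segment_compact.
Qed.

Lemma closed_normc_le (r : R) : closed [set z : C | normc z <= r].
Proof.
move=> z clz /=; apply/ler_addgt0Pr => e e0.
have [|y [yr]] := clz (ball z e%:C); first by apply: nbhsx_ballx; rewrite ltcR.
rewrite -ball_normE /= Defs.normrE ltcR => zy; rewrite -[z](subrK y).
by apply: (le_trans (le_normcD _ _)); rewrite addrC lerD // ltW.
Qed.

Lemma normc_ge_ReIm (z : R[i]) :
  `|complex.Re z| <= normc z /\ `|complex.Im z| <= normc z.
Proof.
by case: z => x y /=; rewrite -!sqrtr_sqr !ler_wsqrtr ?lerDl ?lerDr ?sqr_ge0.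
Qed.

End ComplexPlane.


Section PointwiseTopology.
Variables (I : choiceType) (K : numFieldType).
Implicit Types (f g : {ptws I -> K}) (v : I).

Lemma continuous_coordinate v : continuous (fun f : {ptws I -> K} => f v).
Proof. exact: (@proj_continuous I (fun=> K : topologicalType) v). Qed.

Lemma near_coordinate f v (d : K) : 0 < d ->
  \forall g \near f, `|f v - g v| < d.
Proof.
move=> d0.
have h := @continuous_coordinate v f _ (nbhsx_ballx (f v) d d0).
rewrite /fmap /= in h.
refine (@filterS _ (nbhs f) _ _ _ _ h).
move=> g /=; rewrite -ball_normE.
done.
Qed.

Lemma near_coordinates (D : {fset I}) (d : I -> K) f : (forall v, 0 < d v) ->
  \forall g \near f, forall v, v \in D -> `|f v - g v| < d v.
Proof.
move=> d0.
have : nbhs f (\bigcap_(v in [set` D]) [set g | `|f v - g v| < d v]).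
  refine (@filter_bigI _ _ D _ (nbhs f) _ _).
  move=> v _; exact: near_coordinate.
by move=> h; refine (@filterS _ (nbhs f) _ _ _ _ h) => g gD v; exact: gD.
Qed.
End PointwiseTopology.

Section Sufficiency.
Variables (R : realType) (G : graph) (a : G).
Implicit Types (v w : G).
Local Notation C := (R[i] : numFieldType).
Local Notation normc := Normc.normc.

(** By linear growth the values at each vertex stay in a fixed compact set, so
    this is Tychonoff's theorem. *)
Lemma compact_lip_ball (r : R) :
  compact (lip_ball a r : set {ptws G -> C}).
Proof.
pose sq v : set C := let c := r * (dist a v).+1%:R in
  [set z | `|complex.Re z| <= c /\ `|complex.Im z| <= c].
pose E (vw : G * G) : set {ptws G -> C} :=
  [set f | adj vw.1 vw.2 -> normc (f vw.1 - f vw.2) <= r].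
pose B : set {ptws G -> C} := [set f | normc (f a) <= r].
have clB : closed B.
  apply: (@closed_comp _ _ (fun f : {ptws G -> C} => f a)
    [set z | normc z <= r]); last exact: closed_normc_le.
  by move=> f _; exact: continuous_coordinate.
have clE vw : closed (E vw).
  have [vwP|vwP] := boolP (adj vw.1 vw.2); last first.
    rewrite (_ : E vw = setT); first exact: closedT.
    by apply/seteqP; split=> // f _; rewrite /E /= (negbTE vwP).
  rewrite (_ : E vw = (fun f : {ptws G -> C} => f vw.1 - f vw.2) @^-1`
    [set z | normc z <= r]); last first.
    by apply/seteqP; split=> f; rewrite /E /= ?vwP // => fE; exact: fE.
  apply: closed_comp => [f _|]; last exact: closed_normc_le.
  exact: (@cvgB C C _ _ _ (fun f : {ptws G -> C} => f vw.1) (fun f => f vw.2) _ _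
    (@continuous_coordinate G C vw.1 f) (@continuous_coordinate G C vw.2 f)).
rewrite (_ : lip_ball a r = [set f | forall v, sq v (f v)] `&`
   (B `&` \bigcap_(vw in setT) E vw)); last first.
  apply/seteqP; split=> [f fr|f [_ [fa fE]]]; last first.
    by split=> // v w vw; exact: (fE (v, w)).
  split=> [v|]; last by split=> [|vw _ vwP]; [case: fr|apply: fr.2].
  have [Rf If] := normc_ge_ReIm (f v).
  by split; apply: le_trans (lip_ball_growth v fr).
apply: compact_closedI; last by apply: closedI => //; apply: closed_bigI.
by apply: (@tychonoff G (fun=> C : topologicalType)) => v; exact: compact_square.
Qed.

Variable psi : G -> R[i].
Hypothesis weight0 : vanishes_at_infty a (mult_weight a psi).

Lemma lip_in_ball (f : lip R a) : exists r, lip_ball a r f.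
Proof.
by exists (normc (f a) + lipschitz_const f); apply: lip_norm_ball; rewrite lip_normrE.
Qed.

Lemma mult_lip (f : lip R a) : (fun v => psi v * f v) \in @lip_pred R G.
Proof.
have [M wM] := vanishes_bounded weight0; have [r fr] := lip_in_ball f.
apply/asboolP; exists (r * M) => _ [v [w [vw ->]]].
apply: (le_trans (mult_variation_le psi fr vw)).
by rewrite ler_wpM2l ?(lip_ball_ge0 fr).
Qed.

Lemma mult_little (f : lip R a) : Lip a (mult_lip f) \in @little_lip_pred R G a.
Proof.
have [r fr] := lip_in_ball f; have r0 := lip_ball_ge0 fr.
apply/asboolP => e e0; have r1 : 0 < r + 1 by rewrite ltr_wpDl.
have [|n far] := weight0 (eps := e / (r + 1)); first by rewrite divr_gt0.
exists n => v /far; rewrite !ger0_norm ?mult_weight_ge0 ?max_variation_ge0 //.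
rewrite ltr_pdivlMr // => we; apply: le_lt_trans we.
apply: max_variation_le => [|w vw].
  by rewrite mulr_ge0 ?mult_weight_ge0 // ltW.
apply: (le_trans (mult_variation_le psi fr vw)).
by rewrite mulrC ler_wpM2l ?mult_weight_ge0 // lerDl.
Qed.

Definition mult_little_lip (f : lip R a) : little_lip R a :=
  LittleLip (mult_little f).

Lemma mult_little_lip_linear : linear mult_little_lip.
Proof.
move=> c f g; apply/val_inj/val_inj/funext => v.
rewrite -[LHS]/(psi v * (c * f v + g v)).
rewrite -[RHS]/(c * (psi v * f v) + psi v * g v); ring.
Qed.

HB.instance Definition _ := GRing.isLinear.Build R[i] (lip R a) (little_lip R a)
  *:%R mult_little_lip mult_little_lip_linear.

(** This is the continuity of [f |-> psi f] from pointwise convergence to the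
    norm. Far from [a] the weight makes the variation of
    [psi * (f - g)] small for all [f] and [g] in the ball at once; on the
    finitely many vertices that remain, pointwise closeness suffices. *)
Lemma mult_near (r : R) (f : {ptws G -> C}) (e : R) : 0 < e -> lip_ball a r f ->
  \forall g \near f, lip_ball a r g ->
    normc (psi a * (f a - g a)) <= e /\ forall v w, adj v w ->
    normc (psi v * (f v - g v) - psi w * (f w - g w)) <= e.
Proof.
move=> e0 fr; have r0 := lip_ball_ge0 fr.
have s0 : 0 < r + r + 1 by rewrite ltr_wpDl ?addr_ge0.
have [|n far] := weight0 (eps := e / (r + r + 1)); first by rewrite divr_gt0.
pose D : {fset G} := fset_set [set v | (dist a v <= n.+1)%N].
have inD v : (v \in D) = (dist a v <= n.+1)%N.
  rewrite in_fset_set; last exact: finite_ball.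
  by apply/idP/idP => [/set_mem //|vn]; apply/mem_set.
pose d v : R := e / 2 / (normc (psi v) + 1).
have d0 v : 0 < (d v)%:C by rewrite ltcR !divr_gt0 // ltr_wpDl ?normc_ge0.
refine (@filterS _ (nbhs f) _ _ _ _ (near_coordinates D f d0)) => g gnear gr.
have gD v : v \in D -> normc (psi v * (f v - g v)) <= e / 2.
  move=> /gnear; rewrite Defs.normrE ltcR ltr_pdivlMr; last first.
    by rewrite ltr_wpDl ?normc_ge0.
  move=> /ltW; apply: le_trans.
  by rewrite Normc.normcM mulrC ler_wpM2l ?normc_ge0 // lerDl.
split=> [|v w vw].
  by apply: le_trans (gD a _) _; [rewrite inD distvv|lra].
case: (leqP (dist a v) n) => vn; last first.
  apply: (le_trans (mult_variation_le psi (lip_ballB fr gr) vw)).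
  have := far v vn; rewrite ger0_norm ?mult_weight_ge0 // ltr_pdivlMr // => /ltW.
  by apply: le_trans; rewrite mulrC ler_wpM2l ?mult_weight_ge0 // lerDl.
apply: (le_trans (le_normcD _ _)); rewrite normcN [e]splitr.
by rewrite lerD ?gD // inD; have := dist_adj_le a vw; lia.
Qed.

Lemma mult_little_lip_compact : compact_operator mult_little_lip.
Proof.
move=> A [M [Mreal bA]].
pose r : R := normc M + 1.
have Ar f : A f -> lip_ball a r f.
  move=> Af; apply: lip_norm_ball; apply: bA Af.
  apply: (le_lt_trans (real_ler_norm Mreal)).
  by rewrite Defs.normrE ltcR ltrDl.
(* The default value 0 is taken outside the Lipschitz functions only, hence
   never on the ball. *)
pose Phi (q : {ptws G -> C}) :=
  mult_little_lip (insubd (0 : lip R a) (q : G -> R[i])).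
have PhiE q v : lip_ball a r q -> Phi q v = psi v * q v.
  move=> /lip_ball_lip qL.
  rewrite -[LHS]/(psi v *
    (val (insubd (0 : lip R a) (q : G -> R[i])) : G -> R[i]) v).
  by rewrite val_insubd qL.
apply: (@precompact_subset _ _ (Phi @` lip_ball a r)).
  move=> _ [f Af <-]; exists f; first exact: Ar.
  by apply/val_inj/val_inj/funext => v; rewrite -[LHS]/(Phi f v) PhiE //; exact: Ar.
apply: compact_precompact; first exact: norm_hausdorff.
apply: (@continuous_compact {ptws G -> C} _ Phi (lip_ball a r));
  last exact: compact_lip_ball.
apply/subspace_continuousP => f fr.
apply/cvgrPdist_lt => _ /gt0_complexP[e e0 ->].
rewrite near_withinE; have e4 : 0 < e / 4 by rewrite divr_gt0.
refine (@filterS {ptws G -> C} (nbhs (f : {ptws G -> C})) _ _ _ _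
  (mult_near e4 fr)) => g gP gr.
have [ga gE] := gP gr.
have dE v : (Phi f - Phi g) v = psi v * (f v - g v).
  by rewrite -[LHS]/(Phi f v - Phi g v) !PhiE // mulrBr.
apply: (@le_lt_trans _ _ (e / 4 + e / 4)%:C); last by rewrite ltcR; lra.
apply: lip_norm_le => [|v w vw]; first by rewrite dE.
by rewrite !dE gE.
Qed.

End Sufficiency.

(** * The equivalence *)

Section LittleInLip.
Variables (R : realType) (G : graph) (a : G).

Definition little_incl : {linear little_lip R a -> lip R a} := \val.

Lemma little_incl_bounded : bounded_operator little_incl.
Proof. by exists 1 => f; rewrite mul1r. Qed.

End LittleInLip.

Theorem theorem7p2 (R : realType) (G : graph) (a : G) (psi : G -> R[i])
    (psi_bounded : mult_bounded_lip a psi \/ mult_bounded_little_lip a psi) :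
  (mult_compact_lip a psi <-> mult_compact_little_lip a psi) /\
  (mult_compact_little_lip a psi <->
     vanishes_at_infty a psi /\
     vanishes_at_infty a (fun v => (dist a v)%:R * max_variation psi v)).
Proof.
pose decay := vanishes_at_infty a psi /\
  vanishes_at_infty a (fun v => (dist a v)%:R * max_variation psi v).
have incl_bdd := little_incl_bounded R a.
have necessity (S : {linear little_lip R a -> lip R a}) :
    (forall f v, S f v = psi v * f v) -> compact_operator S -> decay.
  move=> Sm Sc; split; first exact: compact_mult_vanishes Sm Sc.
  exact: compact_mult_variation_vanishes Sm Sc.
have lip_decay : mult_compact_lip a psi -> decay.
  move=> [T Tm /(compact_comp_bounded incl_bdd)]; apply: necessity => f v.
  exact: Tm.
have little_decay : mult_compact_little_lip a psi -> decay.
  move=> [T Tm Tc]; apply: (necessity _ _ (bounded_comp_compact Tc incl_bdd)).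
  by move=> f v; exact: Tm.
have decay_lip : decay -> mult_compact_lip a psi.
  move=> [psi0 var0]; have w0 := mult_weight_vanishes psi0 var0.
  exists (little_incl R a \o mult_little_lip w0 : {linear _ -> _}) => //.
  exact: bounded_comp_compact (mult_little_lip_compact w0) incl_bdd.
have decay_little : decay -> mult_compact_little_lip a psi.
  move=> [psi0 var0]; have w0 := mult_weight_vanishes psi0 var0.
  exists (mult_little_lip w0 \o little_incl R a : {linear _ -> _}) => //.
  exact: compact_comp_bounded incl_bdd (mult_little_lip_compact w0).
split; split=> [h|h].
- exact: decay_little (lip_decay h).
- exact: decay_lip (little_decay h).
- exact: little_decay.
- exact: decay_little.
Qed.
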